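(* Let $n\ge5$. Any (two-sided) ideal of $\mathcal{E}_n=\mathrm{End}(\mathcal{T}_n)$ takes one of the following forms: (1) $\mathcal{E}_n$ (the only ideal containing automorphisms); (2) $\mathcal{E}_n\setminus\mathcal{G}_n$ (the only proper ideal containing elements of odd type); (3) $X\cup Y\cup E_2\cup C\cup E_1$ (ideals containing elements of even type, but no elements of odd type); or (4) $Y\cup Y^+\cup Z\cup E_1$ (ideals containing only elements of trivial or non-permutation type), where the sets $X$, $Y$ and $Z$ are (possibly empty) unions of orbits taken from the sets $A$, $B$ and $C$ respectively.
   Context: Maps are written on the right and composed left to right. $\mathcal{T}_n$ is the full transformation semigroup of all maps $\{1,\dots,n\}\to\{1,\dots,n\}$; $\mathcal{S}_n$, $\mathcal{A}_n$ are the symmetric and alternating groups, $\mathrm{id}$ the identity map, and $s^g=g^{-1}sg$ for $g\in\mathcal{S}_n$, $s\in\mathcal{T}_n$. $\mathcal{E}_n=\mathrm{End}(\mathcal{T}_n)$ is the monoid of all semigroup endomorphisms of $\mathcal{T}_n$ (not required to fix $\mathrm{id}$), and $\mathcal{G}_n=\mathrm{Aut}(\mathcal{T}_n)$. For $g\in\mathcal{S}_n$, $\psi_g:s\mapsto s^g$. For $t,e\in\mathcal{T}_n$, $\phi_{t,e}$ sends $s\mapsto t$ if $s\in\mathcal{S}_n\setminus\mathcal{A}_n$, $s\mapsto t^2$ if $s\in\mathcal{A}_n$, $s\mapsto e$ if $s\in\mathcal{T}_n\setminus\mathcal{S}_n$. By a known theorem of Schein and Teclezghi, $\mathcal{G}_n=\{\psi_g:g\in\mathcal{S}_n\}$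 and, for $n\neq4$, $\mathcal{E}_n=\mathcal{G}_n\cup\{\phi_{t,e}: t^3=t,\ te=et=e^2=e\}$. Define the following subsets of $\mathcal{E}_n\setminus\mathcal{G}_n$ (in each case $\phi_{t,e}$ is assumed to lie in $\mathcal{E}_n$): $E_3=\{\phi_{t,e}: t\in\mathcal{S}_n\setminus\mathcal{A}_n,\ e\ne\mathrm{id}\}$; $A=\{\phi_{t,e}: t\in\mathcal{A}_n,\ t\neq\mathrm{id},\ e\neq\mathrm{id}\}$; $B=\{\phi_{t,e}: t\in\mathcal{T}_n\setminus\mathcal{S}_n,\ t\ne t^2,\ t^2\neq e,\ e\ne\mathrm{id}\}$; $E_2=\{\phi_{\mathrm{id},e}: e\ne\mathrm{id}\}$; $C=\{\phi_{t,e}: t\in\mathcal{T}_n\setminus\mathcal{S}_n,\ t=t^2,\ t\neq e,\ e\neq\mathrm{id}\}$; $E_1=\{\phi_{e,e}\}$. Elements of $E_3$ have odd type, those of $A\cup E_2$ even type, those of $B\cup C\cup(E_1\setminus\{\phi_{\mathrm{id},\mathrm{id}}\})$ non-permutation type, and $\phi_{\mathrm{id},\mathrm{id}}$ has trivial type. The orbit of $\alpha\in\mathcal{E}_n$ is $\alpha\mathcal{G}_n=\{\alpha\psi_g:g\in\mathcal{S}_n\}$. For $\alpha=\phi_{t,e}\in\mathcal{E}_n$, $\alpha^+=\phi_{t^2,e}$ (this is $\gamma\alpha$ for any $\gamma$ of even type), and $Y^+=\{\alpha^+:\alpha\in Y\}$. Ideals are non-empty. *)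

(* Defs.v *)
From HB Require Import structures.
From mathcomp Require Import all_boot all_fingroup all_solvable.

Set Implicit Arguments.
Unset Strict Implicit.
Unset Printing Implicit Defensive.

Local Open Scope group_scope.

(* T_n on the points {0, ..., n-1}; maps are written on the right, so s * t is
   "first s, then t" (as for 'S_n in MathComp). *)
Definition transf (n : nat) : Type := {ffun 'I_n -> 'I_n}.

HB.instance Definition _ n := Finite.copy (transf n) {ffun 'I_n -> 'I_n}.

Definition tr_fun n (s : transf n) : 'I_n -> 'I_n := fun_of_fin s.
Coercion tr_fun : transf >-> Funclass.

Definition tr_mul n (s t : transf n) : transf n := [ffun x => t (s x)].
Definition tr_one n : transf n := [ffun x => x].

Fact tr_mulA n : associative (@tr_mul n).
Proof. by move=> s t u; apply/ffunP => x; rewrite /tr_mul /tr_fun !ffunE. Qed.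

Fact tr_mul1 n : left_id (@tr_one n) (@tr_mul n).
Proof. by move=> s; apply/ffunP => x; rewrite /tr_mul /tr_fun !ffunE. Qed.

Fact tr_mulr1 n : right_id (@tr_one n) (@tr_mul n).
Proof. by move=> s; apply/ffunP => x; rewrite /tr_mul /tr_fun !ffunE. Qed.

HB.instance Definition _ n :=
  isMonoid.Build (transf n) (@tr_mulA n) (@tr_mul1 n) (@tr_mulr1 n).

Definition tr_perm n (g : 'S_n) : transf n := [ffun x => g x].

Definition Sn (n : nat) : {set transf n} := [set tr_perm g | g : 'S_n].
Definition An (n : nat) : {set transf n} := [set tr_perm g | g in 'Alt_('I_n)].

(* E_n = End(T_n) as semigroup endomorphisms: preservation of the identity is
   not required. *)
Definition is_endo n (f : {ffun transf n -> transf n}) : bool :=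
  [forall s : transf n, forall t : transf n, f (s * t) == f s * f t].

Record endo (n : nat) : Type :=
  Endo { endo_val : {ffun transf n -> transf n}; _ : is_endo endo_val }.

HB.instance Definition _ n := [isSub for @endo_val n].
HB.instance Definition _ n := [Finite of endo n by <:].

Definition endo_fun n (a : endo n) : transf n -> transf n :=
  fun_of_fin (endo_val a).
Coercion endo_fun : endo >-> Funclass.

Lemma endoM n (a : endo n) (s t : transf n) : a (s * t) = a s * a t.
Proof. by case: a => f fM; apply/eqP/(forallP (forallP fM s) t). Qed.

Fact endo_mul_subproof n (a b : endo n) : is_endo [ffun s => b (a s)].
Proof.
by apply/forallP => s; apply/forallP => t; rewrite !ffunE; apply/eqP; rewrite !endoM.
Qed.

Fact endo_one_subproof n : is_endo [ffun s : transf n => s].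
Proof. by apply/forallP => s; apply/forallP => t; rewrite !ffunE. Qed.

Definition endo_mul n (a b : endo n) : endo n := Endo (endo_mul_subproof a b).
Definition endo_one n : endo n := Endo (endo_one_subproof n).

Lemma endoP n (a b : endo n) : a =1 b -> a = b.
Proof. by move=> ab; apply/val_inj/ffunP. Qed.

Lemma endo_mulE n (a b : endo n) s : endo_mul a b s = b (a s).
Proof. by rewrite {1}/endo_fun /= ffunE. Qed.

Lemma endo_oneE n s : endo_one n s = s.
Proof. by rewrite /endo_fun /= ffunE. Qed.

Fact endo_mulA n : associative (@endo_mul n).
Proof. by move=> a b c; apply: endoP => s; rewrite !endo_mulE. Qed.

Fact endo_mul1 n : left_id (endo_one n) (@endo_mul n).
Proof. by move=> a; apply: endoP => s; rewrite endo_mulE endo_oneE. Qed.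

Fact endo_mulr1 n : right_id (endo_one n) (@endo_mul n).
Proof. by move=> a; apply: endoP => s; rewrite endo_mulE endo_oneE. Qed.

HB.instance Definition _ n :=
  isMonoid.Build (endo n) (@endo_mulA n) (@endo_mul1 n) (@endo_mulr1 n).

(* G_n = Aut(T_n); on a finite set injective = bijective. *)
Definition Gn (n : nat) : {set endo n} := [set a : endo n | injectiveb a].

Definition phi n (t e : transf n) : {ffun transf n -> transf n} :=
  [ffun s => if s \in Sn n :\: An n then t
             else if s \in An n then t ^+ 2
             else e].

(* { phi_{t,e} | phi_{t,e} \in E_n and P t e } *)
Definition phi_set n (P : transf n -> transf n -> bool) : {set endo n} :=
  [set a : endo n | [exists t : transf n, exists e : transf n, (endo_val a == phi t e) && P t e]].

Definition endoE3 n := phi_set (fun t e : transf n =>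
  (t \in Sn n :\: An n) && (e != 1)).
Definition endoA n := phi_set (fun t e : transf n =>
  [&& t \in An n, t != 1 & e != 1]).
Definition endoB n := phi_set (fun t e : transf n =>
  [&& t \notin Sn n, t != t ^+ 2, t ^+ 2 != e & e != 1]).
Definition endoE2 n := phi_set (fun t e : transf n => (t == 1) && (e != 1)).
Definition endoC n := phi_set (fun t e : transf n =>
  [&& t \notin Sn n, t == t ^+ 2, t != e & e != 1]).
Definition endoE1 n := phi_set (fun t e : transf n => t == e).

Definition trivial_type n := phi_set (fun t e : transf n => (t == 1) && (e == 1)).
Definition odd_type n := endoE3 n.
Definition even_type n := endoA n :|: endoE2 n.
Definition nonperm_type n := endoB n :|: endoC n :|: (endoE1 n :\: trivial_type n).

Definition endo_orbit n (a : endo n) : {set endo n} := [set a * g | g in Gn n].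

Definition orbit_union n (S X : {set endo n}) : Prop :=
  exists2 P : {set {set endo n}},
    P \subset [set endo_orbit a | a in S] & X = cover P.

(* Y^+ = { phi_{t^2,e} | phi_{t,e} \in Y }; phi_{t^2,e} is an endomorphism as
   soon as phi_{t,e} is, so no element is lost by working in E_n. *)
Definition plus_set n (Y : {set endo n}) : {set endo n} :=
  [set b : endo n | [exists a in Y, exists t : transf n, exists e : transf n,
     (endo_val a == phi t e) && (endo_val b == phi (t ^+ 2) e)]].

Definition is_ideal n (I : {set endo n}) : Prop :=
  I != set0 /\ forall a b : endo n, a \in I -> a * b \in I /\ b * a \in I.

Definition ideal_form1 n (I : {set endo n}) : Prop := I = [set: endo n].

Definition ideal_form2 n (I : {set endo n}) : Prop := I = [set: endo n] :\: Gn n.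

Definition ideal_form3 n (I : {set endo n}) : Prop :=
  exists X Y : {set endo n},
    [/\ orbit_union (endoA n) X, orbit_union (endoB n) Y
      & I = X :|: Y :|: endoE2 n :|: endoC n :|: endoE1 n].

Definition ideal_form4 n (I : {set endo n}) : Prop :=
  exists Y Z : {set endo n},
    [/\ orbit_union (endoB n) Y, orbit_union (endoC n) Z
      & I = Y :|: plus_set Y :|: Z :|: endoE1 n].

(* Main.v *)
Require Import Defs.
From mathcomp Require Import all_boot all_fingroup all_solvable.

(** An endomorphism [a] of T_n is determined by its values on the constant maps:
    [const x * s = const (s x)], so [a] is injective as soon as it separates
    constants.  Since T_n moves any pair of distinct points to any pair of
    points, an endomorphism that identifies two constants identifies them all,
    with a common value [e].  Then the permutations [a (tr_perm g)], restricted
    to the image of the idempotent [a 1], fix every point of the image of [e];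
    so A_n acts on at most n - 1 points, which is too few for a faithful
    action.  As A_n is simple, [a] is trivial on it.  All rank n - 1 idempotents
    sending a point to [y] are conjugate under A_n and their product is
    [const y], so [a] sends each of them, and hence every non-permutation,
    to [e].  This proves [endo_cases]: every endomorphism is an automorphism or
    some [phi t e].

    The classification of ideals then rests on two product rules.  On the right,
    [mul_phi] says that [phi t e * b] has parameters [b t] and [b e].  On the
    left, [phi_mul] says that [b * phi t e] is one of the maps with parameters
    [(t, e)], [(t^2, e)], [(e, e)] and [(t^2, t^2)].  Consequently every ideal
    contains E_1; an element of odd type generates all collapsing maps, because
    [phi t e * phi u f = phi u f] when [t] is odd and [e] is not the identity;
    an element of even type generates exactly the maps [phi u f] with
    [u] idempotent besides its own orbit, and these form the union of E_2, C
    and E_1 ([idem_phiE]); and an element of B or C times a collapsing map lies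
    in E_1.  What is left free is a choice of orbits in A and B (given even
    type) or in B and C (otherwise), where B drags its squares B^+ along.  For
    orbits to stay inside A one needs automorphisms to preserve A_n, which
    again follows from [phi_mul] ([Gn_An]). *)

Set Implicit Arguments.
Unset Strict Implicit.
Unset Printing Implicit Defensive.

Section Endomorphisms.
Local Open Scope group_scope.

Variable n : nat.
Implicit Types (s t u e f : transf n) (g h : 'S_n) (x y z : 'I_n).
Implicit Types (a b c : endo n) (I X Y Z S : {set endo n}).

(** * Transformations *)

Lemma transfP s t : s =1 t -> s = t.
Proof. by move=> st; apply/ffunP. Qed.

Lemma transfM s t x : tr_fun (s * t) x = t (s x).
Proof. by rewrite {1}/tr_fun ffunE. Qed.

Lemma transf1 x : tr_fun 1 x = x.
Proof. by rewrite {1}/tr_fun ffunE. Qed.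

Lemma tr_permE g x : tr_perm g x = g x.
Proof. by rewrite {1}/tr_fun ffunE. Qed.

Lemma tr_perm1 : tr_perm 1 = 1 :> transf n.
Proof. by apply: transfP => x; rewrite tr_permE perm1 transf1. Qed.

Lemma tr_permM g h : tr_perm (g * h) = tr_perm g * tr_perm h.
Proof. by apply: transfP => x; rewrite transfM !tr_permE permM. Qed.

Lemma tr_permVK g : tr_perm g * tr_perm g^-1 = 1.
Proof. by rewrite -tr_permM mulgV tr_perm1. Qed.

Lemma tr_perm_inj : injective (@tr_perm n).
Proof.
by move=> g h gh; apply/permP => x; rewrite -!tr_permE gh.
Qed.

Definition const x : transf n := [ffun _ => x].

Lemma constE x y : const x y = x.
Proof. by rewrite {1}/tr_fun ffunE. Qed.

Lemma const_mul x s : const x * s = const (s x).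
Proof. by apply: transfP => y; rewrite transfM !constE. Qed.

Lemma mul_const x s : s * const x = const x.
Proof. by apply: transfP => y; rewrite transfM !constE. Qed.

Lemma SnP s : reflect (injective s) (s \in Sn n).
Proof.
apply: (iffP imsetP) => [[g _ ->] x y | inj_s].
  by rewrite !tr_permE => /perm_inj.
by exists (perm inj_s) => //; apply: transfP => x; rewrite tr_permE permE.
Qed.

Lemma tr_perm_Sn g : tr_perm g \in Sn n.
Proof. exact: imset_f. Qed.

Lemma Sn_left s t : s * t \in Sn n -> s \in Sn n.
Proof.
move/SnP=> inj_st; apply/SnP => x y sxy; apply: inj_st.
by rewrite !transfM sxy.
Qed.

(** A finite set has no injective map that is not bijective: [s] is injective,
    hence onto, and [t] inherits injectivity from [s * t]. *)
Lemma Sn_right s t : s * t \in Sn n -> t \in Sn n.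
Proof.
move=> st_Sn; have /SnP inj_s := Sn_left st_Sn.
have [r sr rs] := injF_bij inj_s.
apply/SnP => x y; rewrite -(rs x) -(rs y) -!transfM.
by move/SnP: st_Sn => inj_st /inj_st ->.
Qed.

Lemma Sn1 : 1 \in Sn n.
Proof. by rewrite -tr_perm1 tr_perm_Sn. Qed.

Lemma An_Sn s : s \in An n -> s \in Sn n.
Proof. by case/imsetP=> g _ ->; apply: tr_perm_Sn. Qed.

Lemma Sn_idem s : s \in Sn n -> s * s = s -> s = 1.
Proof.
move/SnP=> inj_s ss; apply: transfP => x; apply: inj_s.
by rewrite -transfM ss transf1.
Qed.

Lemma tr_perm_An g : (tr_perm g \in An n) = ~~ odd_perm g.
Proof. by rewrite mem_imset ?Alt_even //; apply: tr_perm_inj. Qed.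

Lemma An1 : 1 \in An n.
Proof. by rewrite -tr_perm1 tr_perm_An odd_perm1. Qed.

Lemma nSnP s : s \notin Sn n -> exists x y, x != y /\ s x = s y.
Proof.
move=> sS; have /injectivePn[x [y xy sxy]]: ~~ injectiveb s.
  by apply: contra sS => /injectiveP/SnP.
by exists x, y.
Qed.

(** * The maps [phi t e] *)

Lemma phi_odd t e g : odd_perm g -> phi t e (tr_perm g) = t.
Proof. by move=> og; rewrite ffunE inE tr_perm_Sn tr_perm_An og. Qed.

Lemma phi_An t e s : s \in An n -> phi t e s = t ^+ 2.
Proof. by move=> sA; rewrite ffunE inE sA. Qed.

Lemma phi_sing t e s : s \notin Sn n -> phi t e s = e.
Proof.
move=> sS; rewrite ffunE inE (negPf sS) andbF ifN //.
by apply: contra sS; apply: An_Sn.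
Qed.

Lemma phi_even t e g : ~~ odd_perm g -> phi t e (tr_perm g) = t ^+ 2.
Proof. by rewrite -tr_perm_An; apply: phi_An. Qed.

Lemma transf_cases s : s \notin Sn n \/ exists g, s = tr_perm g.
Proof.
by case: (boolP (s \in Sn n)) => [/imsetP[g _ ->] | ]; [right; exists g | left].
Qed.

Lemma phi_is_endo t e :
  t * t * t = t -> t * e = e -> e * t = e -> e * e = e -> is_endo (phi t e).
Proof.
move=> ttt te et ee; apply/forallP => s; apply/forallP => u; apply/eqP.
have [sS | [g ->]] := transf_cases s.
  have suS : s * u \notin Sn n by apply: contra sS; apply: Sn_left.
  rewrite (phi_sing _ _ suS) (phi_sing _ _ sS).
  have [uS | [h ->]] := transf_cases u; first by rewrite phi_sing.
  case: (boolP (odd_perm h)) => oh; first by rewrite phi_odd.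
  by rewrite phi_even // expg2 mulgA !et.
have [uS | [h ->]] := transf_cases u.
  have suS : tr_perm g * u \notin Sn n by apply: contra uS; apply: Sn_right.
  rewrite (phi_sing _ _ suS) (phi_sing _ _ uS).
  case: (boolP (odd_perm g)) => og; first by rewrite phi_odd.
  by rewrite phi_even // expg2 -mulgA !te.
rewrite -tr_permM; have := odd_permM g h.
case: (boolP (odd_perm g)) => og; case: (boolP (odd_perm h)) => oh /= ogh.
- by rewrite phi_even ?ogh // !phi_odd ?expg2.
- by rewrite phi_odd ?ogh // phi_odd // phi_even // expg2 mulgA.
- by rewrite phi_odd ?ogh // phi_even // phi_odd // expg2.
- by rewrite !phi_even ?ogh // expg2 mulgA ttt.
Qed.

Lemma endo_of_phi t e :
  t * t * t = t -> t * e = e -> e * t = e -> e * e = e ->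
  exists a, endo_val a = phi t e.
Proof. by move=> h1 h2 h3 h4; exists (Endo (phi_is_endo h1 h2 h3 h4)). Qed.

Lemma endo_of_const e : e * e = e -> exists a, endo_val a = phi e e.
Proof. by move=> ee; apply: endo_of_phi; rewrite ?ee. Qed.

Lemma phi_ee e s : e * e = e -> phi e e s = e.
Proof. by move=> ee; rewrite ffunE expg2 ee !if_same. Qed.

(** * Parameters of the collapsing maps, for at least five points *)

Hypothesis n_ge5 : (5 <= n)%N.

Lemma exists_point : exists x, true.
Proof. by exists (Ordinal (leq_trans (isT : 0 < 5) n_ge5)). Qed.

Lemma avoid3 x y z : exists w : 'I_n, [/\ w != x, w != y & w != z].
Proof.
have: ~~ ([set: 'I_n] \subset [:: x; y; z]).
  apply: contraL n_ge5 => /subset_leq_card; rewrite cardsT card_ord.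
  move/leq_trans/(_ (card_size _)) => /= n3.
  by rewrite -ltnNge ltnS (leq_trans n3).
by case/subsetPn=> w _; rewrite !inE !negb_or => /and3P[]; exists w.
Qed.

(** The pair [tr_perm g], [const x] gives parameters of an endomorphism of odd
    type, and conversely detects the parameters of any [phi t e]. *)
Lemma odd_involution_fixing :
  exists g x, [/\ odd_perm g, tr_perm g * tr_perm g = 1 & g x = x].
Proof.
have [x _] := exists_point; have [y [yx _ _]] := avoid3 x x x.
have [z [zx zy _]] := avoid3 x y y.
exists (tperm y z), x; split; first by rewrite odd_tperm eq_sym.
  by rewrite -tr_permM tperm2 tr_perm1.
by rewrite tpermD.
Qed.

Lemma const_nSn x : const x \notin Sn n.
Proof.
have [y [yx _ _]] := avoid3 x x x.
apply/negP => /SnP/(_ x y); rewrite !constE => /(_ erefl) xy.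
by rewrite xy eqxx in yx.
Qed.

Lemma idem_nSn s : s * s = s -> (s \notin Sn n) = (s != 1).
Proof.
move=> ss; apply/idP/idP; first by apply: contra => /eqP ->; apply: Sn1.
by apply: contra => /Sn_idem/(_ ss)->.
Qed.

(** An odd permutation and a constant map read off the two parameters. *)
Lemma phi_inj t e t' e' : phi t e = phi t' e' -> t = t' /\ e = e'.
Proof.
move=> tt'; have [g [x [og _ _]]] := odd_involution_fixing; split.
  by have := congr1 (fun p : {ffun _ -> _} => p (tr_perm g)) tt';
    rewrite /= !phi_odd.
have := congr1 (fun p : {ffun _ -> _} => p (const x)) tt'.
by rewrite /= !phi_sing // const_nSn.
Qed.

Lemma in_phi_set P a t e : endo_val a = phi t e -> (a \in phi_set P) = P t e.
Proof.
move=> av; rewrite inE; apply/existsP/idP; last first.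
  by move=> Pte; exists t; apply/existsP; exists e; rewrite av eqxx.
by case=> t' /existsP[e' /andP[]]; rewrite av => /eqP/phi_inj[-> ->].
Qed.

(** The relations hold in T_n between an odd involution [g] and a constant map,
    whose images are [t] and [e]. *)
Lemma phi_endoP a t e : endo_val a = phi t e ->
  [/\ t * t * t = t, t * e = e, e * t = e & e * e = e].
Proof.
move=> av; have aE s : a s = phi t e s by rewrite -av.
have [g [x [og gg _]]] := odd_involution_fixing.
have at_ : a (tr_perm g) = t by rewrite aE phi_odd.
have ac y : a (const y) = e by rewrite aE phi_sing ?const_nSn.
split.
- have := endoM a (tr_perm g * tr_perm g) (tr_perm g).
  by rewrite gg mul1g -gg endoM at_.
- by have := endoM a (tr_perm g) (const x); rewrite mul_const ac at_.
- by have := endoM a (const x) (tr_perm g); rewrite const_mul !ac at_.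
- by have := endoM a (const x) (const x); rewrite mul_const !ac.
Qed.

(** * Automorphisms *)

Lemma endo_val_inj : injective (@endo_val n).
Proof. exact: val_inj. Qed.

Lemma endoME a b s : endo_fun (a * b) s = b (a s).
Proof. exact: endo_mulE. Qed.

Lemma endo1E s : endo_fun 1 s = s.
Proof. exact: endo_oneE. Qed.

Lemma GnP a : reflect (injective a) (a \in Gn n).
Proof. by rewrite inE; apply: injectiveP. Qed.

Lemma Gn_mul a b : a \in Gn n -> b \in Gn n -> a * b \in Gn n.
Proof.
move=> /GnP inj_a /GnP inj_b; apply/GnP => s t.
by rewrite !endoME => /inj_b/inj_a.
Qed.

Lemma Gn_one : 1 \in Gn n.
Proof. by apply/GnP => s t; rewrite !endo1E. Qed.

Lemma Gn_left a b : a * b \in Gn n -> a \in Gn n.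
Proof.
by move=> /GnP inj_ab; apply/GnP => s t st; apply: inj_ab; rewrite !endoME st.
Qed.

Lemma Gn_inv a : a \in Gn n -> exists2 b, b \in Gn n & a * b = 1.
Proof.
move=> /GnP inj_a; have [r ar ra] := injF_bij inj_a.
have rM: is_endo [ffun s => r s].
  apply/forallP => s; apply/forallP => t; rewrite !ffunE.
  by apply/eqP/inj_a; rewrite endoM !ra.
have rE s : Endo rM s = r s by rewrite /endo_fun /= ffunE.
exists (Endo rM); last by apply: endoP => s; rewrite endoME rE ar endo1E.
by apply/GnP => s t; rewrite !rE => /(congr1 a); rewrite !ra.
Qed.

Lemma Gn_right a b : a * b \in Gn n -> b \in Gn n.
Proof.
move=> ab; have [r rG] := Gn_inv (Gn_left ab) => ar.
have [r' r'G rr'] := Gn_inv rG.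
have ra : r * a = 1 by rewrite -[a]mulg1 -rr' (mulgA a) ar mul1g.
by rewrite -[b]mul1g -ra -mulgA; apply: Gn_mul.
Qed.

Lemma Gn_1 b : b \in Gn n -> b 1 = 1.
Proof.
move=> /GnP inj_b; have [r br rb] := injF_bij inj_b.
by rewrite -[LHS]mulg1 -[X in _ * X](rb 1) -endoM mul1g.
Qed.

(** Non-permutations are those [s] for which right multiplication by [s]
    identifies two constants, and a permutation can be cancelled. *)
Lemma Gn_Sn b s : b \in Gn n -> (b s \in Sn n) = (s \in Sn n).
Proof.
move=> bG; apply/idP/imsetP => [bS | [g _ ->]].
  have [/nSnP[x [y [xy sxy]]] | [g ->]] := transf_cases s; last by exists g.
  have /(congr1 b) : const x * s = const y * s by rewrite !const_mul sxy.
  rewrite !endoM => bxy; case/eqP: xy.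
  have /GnP inj_b := bG; suff /inj_b cxy : b (const x) = b (const y).
    by rewrite -(constE x x) cxy constE.
  apply: transfP => z; have /SnP := bS; apply.
  by rewrite -!transfM bxy.
by apply: (@Sn_left _ (b (tr_perm g^-1))); rewrite -endoM tr_permVK Gn_1 ?Sn1.
Qed.

(** * Endomorphisms that are not automorphisms *)

Lemma const_inj_Gn a :
  (forall x y, a (const x) = a (const y) -> x = y) -> a \in Gn n.
Proof.
move=> inj_c; apply/GnP => s t st; apply: transfP => x; apply: inj_c.
by rewrite -!const_mul !endoM st.
Qed.

(** If [a] identifies [const x] and [const y], multiplying on the right by a map
    that sends [x] to [u] and [y] to [v] shows that it identifies [const u] and
    [const v]. *)
Lemma nGn_const a : a \notin Gn n -> exists e, forall x, a (const x) = e.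
Proof.
move=> aG; have [x0 _] := exists_point.
exists (a (const x0)) => u; move: u x0.
case: (boolP [forall x, forall y, (a (const x) == a (const y)) ==> (x == y)]).
  move=> inj_c; case/negP: aG; apply: const_inj_Gn => x y /eqP xy; apply/eqP.
  by move/forallP/(_ x)/forallP/(_ y)/implyP: inj_c; apply.
rewrite negb_forall => /existsP[x]; rewrite negb_forall => /existsP[y].
rewrite negb_imply => /andP[/eqP axy xy] u v.
pose s : transf n := [ffun z => if z == x then u else v].
have sx : s x = u by rewrite /tr_fun ffunE eqxx.
have sy : s y = v by rewrite /tr_fun ffunE eq_sym (negPf xy).
by rewrite -sx -sy -!const_mul !endoM axy.
Qed.

Section Collapsing.

Variables (a : endo n) (e : transf n).
Hypothesis ac : forall x, a (const x) = e.

Lemma collapse_l s : e * a s = e.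
Proof.
by have [x _] := exists_point; rewrite -{1}(ac x) -endoM const_mul ac.
Qed.

Lemma collapse_r s : a s * e = e.
Proof. by have [x _] := exists_point; rewrite -(ac x) -endoM mul_const. Qed.

(** The elements [a (tr_perm g)] are units of the local monoid at the
    idempotent [a 1]; they permute the fixed points of [a 1], which are its
    image.  Extending by the identity gives a permutation of all points. *)
Definition unit_act g x := if a 1 x == x then a (tr_perm g) x else x.

Lemma unit_act_in g x : a 1 x = x -> unit_act g x = a (tr_perm g) x.
Proof. by rewrite /unit_act => ->; rewrite eqxx. Qed.

Lemma unit_act_out g x : a 1 x <> x -> unit_act g x = x.
Proof. by rewrite /unit_act; case: eqP. Qed.

Lemma unit_actM g h x : unit_act (g * h) x = unit_act h (unit_act g x).
Proof.
have [x1 | x1] := a 1 x =P x; last by rewrite !unit_act_out.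
have ax1 : a 1 (a (tr_perm g) x) = a (tr_perm g) x.
  by rewrite -transfM -endoM mulg1.
by rewrite !(unit_act_in _ x1) unit_act_in // tr_permM endoM transfM.
Qed.

Lemma unit_act1 x : unit_act 1 x = x.
Proof. by rewrite /unit_act; case: eqP => //; rewrite tr_perm1. Qed.

Lemma unit_act_inj g : injective (unit_act g).
Proof.
apply: (can_inj (g := unit_act g^-1)) => x.
by rewrite -unit_actM mulgV unit_act1.
Qed.

Definition unit_perm g : 'S_n := perm (@unit_act_inj g).

Lemma unit_permM : {in 'Alt_('I_n) &, {morph unit_perm : g h / g * h}}.
Proof. by move=> g h _ _; apply/permP => x; rewrite permM !permE unit_actM. Qed.

Canonical unit_morphism := Morphism unit_permM.

(** As [e * a s = e], the image of [e] is fixed pointwise; so [unit_perm] lands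
    in the stabiliser of a point. *)
Lemma unit_perm_fix g x : unit_perm g (e x) = e x.
Proof. by rewrite permE /unit_act -!transfM !collapse_l eqxx. Qed.

Lemma card_Alt_large : ((n.-1)`! < #|'Alt_('I_n)|)%N.
Proof.
rewrite -(ltn_pmul2l (isT : 0 < 2)) card_Alt card_ord; last first.
  exact: leq_trans n_ge5.
case: n n_ge5 => // m m4; rewrite factS ltn_pmul2r ?fact_gt0 //.
exact: leq_trans m4.
Qed.

(** The kernel of [unit_perm] on the simple group A_n cannot be trivial, since
    the order of A_n exceeds that of a point stabiliser in S_n. *)
Lemma collapse_Alt g : g \in 'Alt_('I_n) -> a (tr_perm g) = a 1.
Proof.
have /simpleP[_ simA]: simple 'Alt_('I_n).
  by apply: simple_Alt5; rewrite card_ord.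
have [x0 _] := exists_point.
case: (simA _ (ker_normal unit_morphism)) => [ker1 | kerA].
  have inj_u : 'injm unit_morphism by rewrite ker1.
  have := card_Alt_large; rewrite -(card_injm inj_u (subxx _)) ltnNge.
  suff /subset_leq_card : unit_perm @* 'Alt_('I_n) \subset perm_on [set~ e x0].
    by rewrite card_perm cardsC1 card_ord => ->.
  apply/subsetP => _ /morphimP[h _ _ ->]; apply/subsetP => x; rewrite !inE.
  by apply: contra => /eqP ->; rewrite unit_perm_fix.
rewrite -kerA => /mker g1; apply: transfP => x.
have := congr1 (fun p : 'S_n => p (a 1 x)) g1.
by rewrite /= perm1 permE /unit_act -!transfM -!endoM !mul1g eqxx.
Qed.

Definition merge x y : transf n := [ffun z => if z == x then y else z].

Lemma mergeE x y z : merge x y z = if z == x then y else z.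
Proof. by rewrite /tr_fun ffunE. Qed.

Lemma merge_mul s x y : s x = s y -> merge x y * s = s.
Proof.
by move=> sxy; apply: transfP => z; rewrite transfM mergeE; case: eqP => // ->.
Qed.

(** If [x != x'], a 3-cycle through [x], [x'] and a point other than [y] does
    it. *)
Lemma even_moving x x' y : x != y -> x' != y ->
  exists g, [/\ g \in 'Alt_('I_n), g x = x' & g y = y].
Proof.
move=> xy x'y; have [<- | xx'] := eqVneq x x'.
  by exists 1; rewrite group1 !perm1.
have [w [wx wx' wy]] := avoid3 x x' y.
exists (tperm x w * tperm w x').
rewrite Alt_even odd_permM !odd_tperm eq_sym wx wx' !permM.
by rewrite tpermL tpermL !tpermD.
Qed.

(** The two merges are conjugate by an element of A_n, on which [a] is
    trivial. *)
Lemma collapse_merge_eq x x' y :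
  x != y -> x' != y -> a (merge x y) = a (merge x' y).
Proof.
move=> xy x'y; have [g [gA gx gy]] := even_moving xy x'y.
have mE : merge x y * tr_perm g = tr_perm g * merge x' y.
  apply: transfP => z; rewrite !transfM !mergeE !tr_permE.
  by rewrite -gx (inj_eq perm_inj); case: eqP.
have := congr1 a mE; rewrite !endoM collapse_Alt // -!endoM.
by rewrite mulg1 mul1g.
Qed.

Definition merge_all (r : seq 'I_n) y : transf n :=
  [ffun z => if z \in r then y else z].

Lemma merge_allE r y z : merge_all r y z = if z \in r then y else z.
Proof. by rewrite /tr_fun ffunE. Qed.

Lemma merge_all_cons x r y : merge_all (x :: r) y = merge x y * merge_all r y.
Proof.
apply: transfP => z; rewrite transfM mergeE !merge_allE inE.
by case: eqP => //= _; rewrite if_same.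
Qed.

(** Merging all points into [y], one after another, yields [const y]; each step
    has the same idempotent image [d], so [d = d * a (const y) = e]. *)
Lemma collapse_merge x y : x != y -> a (merge x y) = e.
Proof.
move=> xy; set d := a _.
have dd : d * d = d by rewrite -endoM merge_mul // !mergeE eqxx if_same.
(* Prefixing [d] makes the empty list a harmless base case. *)
have dr (r : seq 'I_n) : y \notin r -> d * a (merge_all r y) = d.
  elim: r => [|z r IHr].
    move=> _; rewrite -endoM; congr (a _); apply: transfP => z.
    by rewrite transfM merge_allE.
  rewrite inE negb_or merge_all_cons endoM mulgA => /andP[yz /IHr dr].
  by rewrite -(collapse_merge_eq xy) 1?eq_sym // -/d dd.
have {dr} := dr (enum (predC1 y)); rewrite mem_enum inE eqxx => /(_ isT) <-.
suff ->: merge_all (enum (predC1 y)) y = const y by rewrite ac collapse_r.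
by apply: transfP => z; rewrite merge_allE constE mem_enum inE; case: eqP.
Qed.

Lemma collapse_sing s : s \notin Sn n -> a s = e.
Proof.
case/nSnP=> x [y [xy sxy]].
by rewrite -(merge_mul sxy) endoM collapse_merge // collapse_l.
Qed.

Lemma collapse_phi : exists t, endo_val a = phi t e.
Proof.
have [g [_ [og gg _]]] := odd_involution_fixing.
exists (a (tr_perm g)); apply/ffunP => s; rewrite -/(endo_fun a s).
have [sS | [h ->]] := transf_cases s.
  by rewrite phi_sing // collapse_sing.
have aA k : ~~ odd_perm k -> a (tr_perm k) = a 1.
  by move=> ek; apply: collapse_Alt; rewrite Alt_even.
case: (boolP (odd_perm h)) => oh; last first.
  by rewrite phi_even // expg2 -endoM gg aA.
(* [tr_perm h = tr_perm (h * g) * tr_perm g] with [h * g] even. *)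
rewrite phi_odd // -[tr_perm h]mulg1 -gg mulgA endoM -tr_permM aA.
  by rewrite -endoM mul1g.
by rewrite odd_permM oh og.
Qed.

End Collapsing.

(** The theorem of Schein and Teclezghi for at least five points, without the
    determination of the automorphisms. *)
Lemma endo_cases a : a \in Gn n \/ exists t e, endo_val a = phi t e.
Proof.
case: (boolP (a \in Gn n)) => [| /nGn_const[e ac]]; first by left.
by right; have [t at_] := collapse_phi ac; exists t, e.
Qed.

Lemma phi_nGn a t e : endo_val a = phi t e -> a \notin Gn n.
Proof.
move=> av; apply/negP => /GnP inj_a.
have [x _] := exists_point; have [y [yx _ _]] := avoid3 x x x.
case/eqP: yx; rewrite -(constE y x) (_ : const y = const x) ?constE //.
by apply: inj_a; rewrite /endo_fun av !phi_sing ?const_nSn.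
Qed.
(** * Products in the endomorphism monoid *)

Lemma mul_phi a b t e :
  endo_val a = phi t e -> endo_val (a * b) = phi (b t) (b e).
Proof.
move=> av; apply/ffunP => s; rewrite -/(endo_fun (a * b) s) endoME.
rewrite {2}/endo_fun av !ffunE; case: ifP => // _.
by case: ifP => // _; rewrite !expg2 endoM.
Qed.

Lemma phi_val t e s : [\/ phi t e s = t, phi t e s = t ^+ 2 | phi t e s = e].
Proof.
rewrite ffunE; case: ifP => _; first by constructor 1.
by case: ifP => _; [constructor 2 | constructor 3].
Qed.

(** The product is again non-injective, hence some [phi t' e'], and [t'], [e']
    are the images under [phi t e] of the values of [b] at an odd permutation
    and at a constant.  The latter value is idempotent, so it is either the
    identity, which forces the former to be the identity too, or not a
    permutation. *)
Lemma phi_mul a b t e : endo_val a = phi t e ->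
  [\/ endo_val (b * a) = phi t e, endo_val (b * a) = phi (t ^+ 2) e,
      endo_val (b * a) = phi e e | endo_val (b * a) = phi (t ^+ 2) (t ^+ 2)].
Proof.
move=> av; have aE s : a s = phi t e s by rewrite /endo_fun av.
have ba_nG : b * a \notin Gn n by apply: contra (phi_nGn av); apply: Gn_right.
have [baG | [t' [e' bav]]] := endo_cases (b * a); first by rewrite baG in ba_nG.
have [g [_ [og _ _]]] := odd_involution_fixing; have [x _] := exists_point.
have t'E : phi t e (b (tr_perm g)) = t'.
  by rewrite -aE -endoME /endo_fun bav phi_odd.
have e'E : phi t e (b (const x)) = e'.
  by rewrite -aE -endoME /endo_fun bav phi_sing ?const_nSn.
have cc : b (const x) * b (const x) = b (const x).
  by rewrite -endoM const_mul constE.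
case: (boolP (b (const x) \in Sn n)) => [/Sn_idem/(_ cc) c1 | cS].
  have g1 : b (tr_perm g) = 1 by rewrite -[LHS]mulg1 -c1 -endoM mul_const.
  by constructor 4; rewrite bav -t'E -e'E c1 g1 phi_An ?An1.
rewrite phi_sing // in e'E; rewrite bav -e'E -t'E.
case: (phi_val t e (b (tr_perm g))) => ->.
- by constructor 1.
- by constructor 2.
- by constructor 3.
Qed.

(** For [a = phi g (const x)] with [g] an odd involution, the permutations sent
    to [1] by [a] are exactly the even ones; by [phi_mul] the map [b * a] still
    sends all of A_n to [1]. *)
Lemma Gn_An b s : b \in Gn n -> s \in An n -> b s \in An n.
Proof.
move=> bG sA; have [g [x [og gg gx]]] := odd_involution_fixing.
have [||||a av] := @endo_of_phi (tr_perm g) (const x).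
- by rewrite gg mul1g.
- exact: mul_const.
- by rewrite const_mul tr_permE gx.
- exact: mul_const.
have aE r : a r = phi (tr_perm g) (const x) r by rewrite /endo_fun av.
have: (b * a) s = (b * a) 1.
  case: (phi_mul b av) => bav; rewrite /endo_fun bav !phi_An ?An1 //.
rewrite !endoME (Gn_1 bG) !aE (phi_An _ _ An1) expg2 gg.
have /imsetP[h _ ->] : b s \in Sn n by rewrite Gn_Sn // An_Sn.
rewrite tr_perm_An; apply: contra_eqN => oh; rewrite phi_odd //.
by apply: contraL og => /eqP g1; rewrite -tr_perm_An g1 An1.
Qed.

(** * Types of collapsing endomorphisms *)

Lemma phi_setP P a :
  a \in phi_set P -> exists t e, endo_val a = phi t e /\ P t e.
Proof.
by rewrite inE => /existsP[t /existsP[e /andP[/eqP av Pte]]]; exists t, e.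
Qed.

Lemma phi_set_sub (P Q : transf n -> transf n -> bool) :
  (forall t e, P t e -> Q t e) -> phi_set P \subset @phi_set n Q.
Proof.
move=> PQ; apply/subsetP => a /phi_setP[t [e [av Pte]]].
by rewrite (in_phi_set _ av) PQ.
Qed.

(** The part common to all ideals that have an element of even type. *)
Definition idem_phi := phi_set (fun t e => t == t ^+ 2).

Lemma phi_e1 a t : endo_val a = phi t 1 -> t = 1.
Proof. by case/phi_endoP=> _; rewrite mulg1. Qed.

Lemma phi_t2 a t e : endo_val a = phi t e -> t \in Sn n -> t ^+ 2 = 1.
Proof.
case/phi_endoP=> ttt _ _ _ tS; apply: Sn_idem; last by rewrite expg2 mulgA ttt.
rewrite expg2; case/imsetP: tS => g _ ->; rewrite -tr_permM; exact: tr_perm_Sn.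
Qed.

Lemma phi_t2e a t e : endo_val a = phi t e -> t ^+ 2 = e -> t = e.
Proof. by case/phi_endoP=> ttt _ et _ t2; rewrite -ttt -expg2 t2. Qed.

Lemma phi_t2_idem a t e : endo_val a = phi t e -> t ^+ 2 * t ^+ 2 = t ^+ 2.
Proof. by case/phi_endoP=> ttt _ _ _; rewrite expg2 mulgA ttt. Qed.

Lemma idem_phiE : endoE2 n :|: endoC n :|: endoE1 n = idem_phi.
Proof.
apply/setP => a; rewrite !in_setU; have [aG | [t [e av]]] := endo_cases a.
  have no P : (a \in @phi_set n P) = false.
    by apply: contraTF aG => /phi_setP[t [e [/phi_nGn]]].
  by rewrite !no.
rewrite !(in_phi_set _ av); have [_ _ _ ee] := phi_endoP av.
have [t1 | t1] /= := eqVneq t 1.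
  by rewrite t1 expg1n eqxx Sn1 /= orbF; case: eqVneq.
have [te | te] /= := eqVneq t e; first by rewrite te expg2 ee eqxx orbT.
have e1 : e != 1.
  by apply: contraNneq t1 => e1; rewrite e1 in av; rewrite (phi_e1 av).
rewrite e1 andbT orbF; case: (boolP (t \in Sn n)) => //= tS.
by rewrite (phi_t2 av tS) (negPf t1).
Qed.

(** When [t] is not idempotent, [e] is neither [1] nor [t ^+ 2], so only the
    position of [t] with respect to A_n and S_n matters. *)
Lemma phi_type a t e : endo_val a = phi t e ->
  [|| a \in endoE3 n, a \in endoA n, a \in endoB n | a \in idem_phi].
Proof.
move=> av; rewrite !(in_phi_set _ av) inE.
case: (eqVneq t (t ^+ 2)) => [_ | t2]; first by rewrite !orbT.
have e1 : e != 1.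
  apply: contraNneq t2 => e1; rewrite e1 in av.
  by rewrite (phi_e1 av) expg1n.
have -> : t ^+ 2 != e.
  by apply: contraNneq t2 => t2; rewrite t2 (phi_t2e av t2).
have -> : t != 1 by apply: contraNneq t2 => ->; rewrite expg1n.
rewrite e1 /= !andbT orbF.
by case: (t \in An n); case: (t \in Sn n).
Qed.

Lemma endoE3_disjoint a : a \in endoE3 n ->
  [&& a \notin endoA n, a \notin endoB n & a \notin idem_phi].
Proof.
case/phi_setP=> t [e [av /andP[/setDP[tS tA] e1]]].
rewrite !(in_phi_set _ av) tS (negPf tA) /=.
by apply: contra tA => /eqP ->; rewrite (phi_t2 av tS) An1.
Qed.

Lemma idem_phi_mulr a b : a \in idem_phi -> a * b \in idem_phi.
Proof.
case/phi_setP=> t [e [av /eqP t2]]; rewrite (in_phi_set _ (mul_phi b av)).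
by rewrite {1}t2 !expg2 endoM.
Qed.

Lemma exists_odd_type : exists a, a \in endoE3 n.
Proof.
have [g [x [og gg gx]]] := odd_involution_fixing.
have [||||a av] := @endo_of_phi (tr_perm g) (const x).
- by rewrite gg mul1g.
- exact: mul_const.
- by rewrite const_mul tr_permE gx.
- exact: mul_const.
exists a; rewrite (in_phi_set _ av) inE tr_perm_An og tr_perm_Sn.
by rewrite -idem_nSn ?const_nSn ?mul_const.
Qed.

(** The witness is [phi 1 (const x)]; multiplying by it on the left
    realises the map from [phi t e] to [phi (t ^+ 2) e]. *)
Lemma exists_even_type : exists2 c, c \in endoE2 n &
  forall a t e, endo_val a = phi t e -> endo_val (c * a) = phi (t ^+ 2) e.
Proof.
have [x _] := exists_point.
have [||||c cv] := @endo_of_phi 1 (const x);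
  rewrite ?mul1g ?mulg1 ?mul_const //; exists c.
  by rewrite (in_phi_set _ cv) eqxx -idem_nSn ?const_nSn ?mul_const.
move=> a t e av; rewrite (mul_phi a cv) /endo_fun av phi_An ?An1 //.
by rewrite phi_sing ?const_nSn.
Qed.

(** * Unions of orbits *)

Definition right_closed X := forall a b, a \in X -> b \in Gn n -> a * b \in X.

(** Stability under right multiplication by automorphisms is the form in which
    ideals produce unions of orbits and consume them. *)
Lemma orbit_unionP S X : right_closed S ->
  orbit_union S X <-> X \subset S /\ right_closed X.
Proof.
move=> closS; split=> [[P /subsetP PS ->] | [/subsetP XS closX]].
  split.
    apply/subsetP => b /bigcupP[O /PS/imsetP[a aS ->] /imsetP[g gG ->]].
    exact: closS.
  move=> b g /bigcupP[O OP]; have /imsetP[a aS OE] := PS O OP.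
  rewrite OE => /imsetP[h hG ->] gG; apply/bigcupP; exists O => //.
  by rewrite OE -mulgA; apply: imset_f; apply: Gn_mul.
exists [set endo_orbit a | a in X]; first by apply: imsetS; apply/subsetP.
apply/setP => a; apply/idP/bigcupP; last first.
  by case=> _ /imsetP[b bX ->] /imsetP[g gG ->]; apply: closX.
move=> aX; exists (endo_orbit a); first exact: imset_f.
by rewrite -{1}[a]mulg1; apply: imset_f; apply: Gn_one.
Qed.

Lemma right_closed_phi_set (P : transf n -> transf n -> bool) :
  (forall t e b, b \in Gn n -> P t e -> P (b t) (b e)) ->
  right_closed (@phi_set n P).
Proof.
move=> PG a b /phi_setP[t [e [av Pte]]] bG.
by rewrite (in_phi_set _ (mul_phi b av)) PG.
Qed.

Lemma Gn_eq1 b s : b \in Gn n -> (b s == 1) = (s == 1).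
Proof. by move=> bG; rewrite -{1}(Gn_1 bG) (inj_eq (GnP _ bG)). Qed.

Lemma right_closedA : right_closed (endoA n).
Proof.
apply: right_closed_phi_set => t e b bG /and3P[tA t1 e1].
by rewrite Gn_An // !Gn_eq1 // t1.
Qed.

Lemma right_closedB : right_closed (endoB n).
Proof.
apply: right_closed_phi_set => t e b bG.
by rewrite Gn_Sn // !expg2 -endoM !(inj_eq (GnP _ bG)) Gn_eq1.
Qed.

Lemma right_closedC : right_closed (endoC n).
Proof.
apply: right_closed_phi_set => t e b bG.
by rewrite Gn_Sn // !expg2 -endoM !(inj_eq (GnP _ bG)) Gn_eq1.
Qed.

(** * Ideals *)

Section OneIdeal.

Variable I : {set endo n}.
Hypothesis idI : is_ideal I.

Lemma ideal_mulr a b : a \in I -> a * b \in I.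
Proof. by case: idI => _ idm aI; case: (idm a b aI). Qed.

Lemma ideal_mull a b : a \in I -> b * a \in I.
Proof. by case: idI => _ idm aI; case: (idm a b aI). Qed.

Lemma ideal_orbit_union S : right_closed S -> orbit_union S (I :&: S).
Proof.
move=> cS; apply/orbit_unionP => //; split; first exact: subsetIr.
by move=> a b /setIP[aI aS] bG; rewrite inE ideal_mulr ?cS.
Qed.

Lemma ideal_Gn a : a \in I -> a \in Gn n -> I = [set: endo n].
Proof.
move=> aI /Gn_inv[b _ ab]; apply/setP => c.
by rewrite in_setT -[c]mul1g -ab !ideal_mulr.
Qed.

(** The maps of E_1 are constant maps with idempotent value, hence right zeros
    of the endomorphism monoid. *)
Lemma ideal_endoE1 : endoE1 n \subset I.
Proof.
apply/subsetP => b /phi_setP[t [e [bv /eqP te]]]; rewrite {t}te in bv.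
have [_ _ _ ee] := phi_endoP bv.
have /set0Pn[a aI] : I != set0 by case: idI.
suff <- : a * b = b by apply: ideal_mulr.
by apply: endoP => s; rewrite endoME /endo_fun bv !phi_ee.
Qed.

(** Here [t] is an odd permutation and [e] is not a permutation, so
    [phi t e * phi u f = phi u f]. *)
Lemma ideal_odd a :
  a \in I -> a \in endoE3 n -> [set: endo n] :\: Gn n \subset I.
Proof.
move=> aI /phi_setP[t [e [av /andP[/setDP[tS tA] e1]]]].
apply/subsetP => b /setDP[_ bG]; have [bG' | [u [f bv]]] := endo_cases b.
  by rewrite bG' in bG.
suff <- : a * b = b by apply: ideal_mulr.
apply: endo_val_inj; rewrite (mul_phi b av) bv /endo_fun bv.
have [_ _ _ ee] := phi_endoP av.
rewrite (phi_sing _ _ (s := e)) ?idem_nSn //.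
case/imsetP: tS tA => g _ ->; rewrite tr_perm_An negbK.
by move=> og; rewrite phi_odd.
Qed.

(** Here [t] is an even permutation and [e] is not a permutation, so
    [phi t e * phi u f = phi (u ^+ 2) f]. *)
Lemma ideal_even a : a \in I -> a \in even_type n -> idem_phi \subset I.
Proof.
move=> aI aE; have [t [e [av tA e1]]] :
    exists t e, [/\ endo_val a = phi t e, t \in An n & e != 1].
  case/setUP: aE => /phi_setP[t [e [av]]]; first by case/and3P; exists t, e.
  by case/andP=> /eqP t1 e1; exists t, e; rewrite {2}t1 An1.
apply/subsetP => b /phi_setP[u [f [bv /eqP u2]]].
suff <- : a * b = b by apply: ideal_mulr.
apply: endo_val_inj; rewrite (mul_phi b av) bv /endo_fun bv.
have [_ _ _ ee] := phi_endoP av.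
by rewrite (phi_sing _ _ (s := e)) ?idem_nSn // phi_An // -u2.
Qed.

Lemma ideal_no_Gn a : a \in I -> (forall b, b \in I -> b \notin odd_type n) ->
  a \notin Gn n.
Proof.
move=> aI no_odd; apply/negP => /(ideal_Gn aI) IT.
have [c c3] := exists_odd_type; have := no_odd c.
by rewrite IT in_setT c3 => /(_ isT).
Qed.

End OneIdeal.

Lemma ideal_form1P I :
  ideal_form1 I <-> is_ideal I /\ (exists2 a, a \in I & a \in Gn n).
Proof.
split=> [-> | [idI [a aI aG]]]; last exact: ideal_Gn aG.
split; last by exists 1; rewrite ?in_setT ?Gn_one.
by split=> [|a b]; rewrite ?in_setT //; apply/set0Pn; exists 1; rewrite in_setT.
Qed.

Lemma ideal_form2P I : ideal_form2 I <->
  [/\ is_ideal I, I <> [set: endo n] & exists2 a, a \in I & a \in odd_type n].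
Proof.
have [c c3] := exists_odd_type.
have odd_nG a : a \in endoE3 n -> a \in [set: endo n] :\: Gn n.
  by case/phi_setP=> t [e [/phi_nGn aG _]]; rewrite in_setD in_setT aG.
split=> [-> | [idI IT [a aI a3]]].
  split; [split | | by exists c; rewrite ?odd_nG].
  - by apply/set0Pn; exists c; apply: odd_nG.
  - move=> a b; rewrite !in_setD !in_setT !andbT => aG.
    by split; apply: contra aG; [apply: Gn_left | apply: Gn_right].
  - by move/setP/(_ 1); rewrite in_setD !in_setT Gn_one.
apply/eqP; rewrite eqEsubset (ideal_odd idI aI a3) andbT; apply/subsetP => b bI.
rewrite in_setD in_setT andbT; apply/negP => bG.
exact/IT/(ideal_Gn idI bI bG).
Qed.

(** For stability of the union: no parameter [t] in it is odd, so multiplying on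
    the right by [phi u f] gives a first parameter [u ^+ 2] or [f], which is
    idempotent; on the left, [phi_mul] either returns the element itself or
    makes the first parameter idempotent. *)
Lemma ideal_form3P I : ideal_form3 I <->
  [/\ is_ideal I, exists2 a, a \in I & a \in even_type n
    & forall a, a \in I -> a \notin odd_type n].
Proof.
split=> [[X [Y []]] | [idI [a aI aE] no_odd]].
  move=> /(orbit_unionP _ right_closedA)[/subsetP XA cX].
  move=> /(orbit_unionP _ right_closedB)[/subsetP YB cY].
  rewrite -setUA -setUA (setUA (endoE2 n)) idem_phiE -setUA => IE.
  have [c c2 _] := exists_even_type.
  have cI : c \in I.
    by rewrite IE !in_setU -idem_phiE !in_setU c2 !orbT.
  have no_odd a : a \in I -> a \notin odd_type n.
    move=> aI; apply/negP => /endoE3_disjoint/and3P[aA aB aQ].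
    move: aI; rewrite IE !in_setU (negPf aQ) orbF => /orP[/XA | /YB].
      by rewrite (negPf aA).
    by rewrite (negPf aB).
  split=> //; last by exists c => //; rewrite in_setU c2 orbT.
  have QI : {subset idem_phi <= I} by move=> a aQ; rewrite IE !in_setU aQ !orbT.
  have phiI a : a \in I -> exists t e, endo_val a = phi t e.
    rewrite IE !in_setU => /or3P[/XA | /YB |] /phi_setP[t [e [av _]]];
    by exists t, e.
  split; first by apply/set0Pn; exists c.
  move=> a b aI; have [t [e av]] := phiI a aI; split.
    have [bG | [u [f bv]]] := endo_cases b.
      move: aI; rewrite IE !in_setU => /or3P[aX | aY | aQ].
      - by rewrite cX.
      - by rewrite cY ?orbT.
      - by rewrite idem_phi_mulr ?orbT.
    apply: QI; rewrite (in_phi_set _ (mul_phi b av)).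
    have := no_odd a aI; have [_ _ _ ee] := phi_endoP av.
    have [_ _ _ ff] := phi_endoP bv.
    rewrite (in_phi_set _ av) expg2 /endo_fun bv.
    have [tS | [g tE]] := transf_cases t; first by rewrite phi_sing // ff.
    rewrite tE inE tr_perm_An tr_perm_Sn andbT negbK.
    case: (boolP (odd_perm g)) => og.
      rewrite negbK => /eqP e1; rewrite e1 in av.
      by move: og; rewrite -[odd_perm g]negbK -tr_perm_An -tE (phi_e1 av) An1.
    by rewrite phi_even // (phi_t2_idem bv).
  have [_ _ _ ee] := phi_endoP av.
  case: (phi_mul b av) => bav.
  - by suff -> : b * a = a by []; apply: endo_val_inj; rewrite bav.
  - apply: QI; rewrite (in_phi_set _ bav) [X in _ == X]expg2.
    by rewrite (phi_t2_idem av).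
  - by apply: QI; rewrite (in_phi_set _ bav) expg2 ee.
  - apply: QI; rewrite (in_phi_set _ bav) [X in _ == X]expg2.
    by rewrite (phi_t2_idem av).
exists (I :&: endoA n), (I :&: endoB n); split.
- exact: ideal_orbit_union right_closedA.
- exact: ideal_orbit_union right_closedB.
rewrite -setUA -setUA (setUA (endoE2 n)) idem_phiE -setUA.
have /subsetP QI := ideal_even idI aI aE.
apply/setP => b; rewrite !in_setU !in_setI.
apply/idP/idP => [bI | ]; last first.
  by case/or3P=> [/andP[] | /andP[] | /QI].
have [bG | [t [e bv]]] := endo_cases b.
  by case/negP: (ideal_no_Gn idI bI no_odd).
by have := phi_type bv; rewrite bI (negPf (no_odd b bI)).
Qed.

Lemma plus_setP Y b : reflect
  (exists a t e,
     [/\ a \in Y, endo_val a = phi t e & endo_val b = phi (t ^+ 2) e])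
  (b \in plus_set Y).
Proof.
rewrite inE; apply: (iffP existsP) => [[a /andP[aY]] | [a [t [e [aY av bv]]]]].
  by case/existsP=> t /existsP[e /andP[/eqP av /eqP bv]]; exists a, t, e.
exists a; rewrite aY; apply/existsP; exists t; apply/existsP; exists e.
by rewrite av bv !eqxx.
Qed.

(** Squaring the first parameter makes it idempotent; it stays different from
    [e], as the definition of B provides. *)
Lemma plus_endoB Y : Y \subset endoB n -> plus_set Y \subset endoC n.
Proof.
move/subsetP=> YB; apply/subsetP => b /plus_setP[a [t [e [/YB aB av bv]]]].
move: aB; rewrite (in_phi_set _ av) (in_phi_set _ bv) => /and4P[tS t2 t2e ->].
rewrite [X in _ == X]expg2 (phi_t2_idem av) eqxx t2e !andbT.
by apply: contra tS; rewrite expg2; apply: Sn_left.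
Qed.

Lemma trivial_endoE1 : trivial_type n \subset endoE1 n.
Proof. by apply: phi_set_sub => t e /andP[/eqP -> /eqP ->]. Qed.

Lemma trivial_or_nonpermE :
  trivial_type n :|: nonperm_type n = endoB n :|: endoC n :|: endoE1 n.
Proof.
apply/setP => a; rewrite !in_setU in_setD.
case: (boolP (a \in trivial_type n)) => [/(subsetP trivial_endoE1) -> | _] //=.
by rewrite orbT.
Qed.

(** For stability of the union: outside E_1 both parameters are
    non-permutations, so multiplying on the right by [phi u f] gives
    [phi f f]; on the left, [phi_mul] gives [phi (t ^+ 2) e], which is what the
    squares of the elements of [Y] are there to absorb. *)
Lemma ideal_form4P I : ideal_form4 I <-> is_ideal I /\
  (forall a, a \in I -> a \in trivial_type n :|: nonperm_type n).
Proof.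
rewrite trivial_or_nonpermE; split; last first.
  move=> [idI np]; exists (I :&: endoB n), (I :&: endoC n); split.
  - exact: ideal_orbit_union right_closedB.
  - exact: ideal_orbit_union right_closedC.
  apply/setP => b; rewrite !in_setU !in_setI; apply/idP/idP => [bI | ].
    move: (np b bI); rewrite bI !in_setU.
    by case/orP=> [/orP[] | ] ->; rewrite ?orbT.
  rewrite -!orbA => /or4P[/andP[] // | | /andP[] // | ]; last first.
    exact: (subsetP (ideal_endoE1 idI)).
  case/plus_setP=> a [t [e [/setIP[aI _] av bv]]].
  have [c _ /(_ a t e av) cav] := exists_even_type.
  rewrite (_ : b = c * a) ?ideal_mull //.
  by apply: endo_val_inj; rewrite bv cav.
case=> Y [Z [/(orbit_unionP _ right_closedB)[YB cY]]].
move=> /(orbit_unionP _ right_closedC)[ZC cZ] IE.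
have /subsetP YpC := plus_endoB YB.
move/subsetP: YB => YB; move/subsetP: ZC => ZC.
have E1I a : a \in endoE1 n -> a \in I.
  by move=> a1; rewrite IE !in_setU a1 !orbT.
have typeI a : a \in I -> [\/ a \in Y, a \in endoC n | a \in endoE1 n].
  rewrite IE !in_setU -!orbA => /or4P[] aI.
  - by constructor 1.
  - by constructor 2; apply: YpC.
  - by constructor 2; apply: ZC.
  - by constructor 3.
split; last first.
  by move=> a /typeI[/YB | |] aT; rewrite !in_setU aT ?orbT.
split.
  have [x _] := exists_point; have [//|a av] := @endo_of_const (const x).
    exact: mul_const.
  by apply/set0Pn; exists a; apply: E1I; rewrite (in_phi_set _ av).
have E1r a b : a \in endoE1 n -> a * b \in endoE1 n.
  move=> /phi_setP[t [e [av /eqP te]]].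
  by rewrite (in_phi_set _ (mul_phi b av)) te.
have singI a : a \in I -> a \in endoE1 n \/
    exists t e, [/\ endo_val a = phi t e, t \notin Sn n & e \notin Sn n].
  case/typeI=> [/YB | | ]; last by left.
  - case/phi_setP=> t [e [av /and4P[tS _ _ e1]]]; right; exists t, e.
    by have [_ _ _ ee] := phi_endoP av; rewrite (idem_nSn ee).
  - case/phi_setP=> t [e [av /and4P[tS _ _ e1]]]; right; exists t, e.
    by have [_ _ _ ee] := phi_endoP av; rewrite (idem_nSn ee).
move=> a b aI; split.
  have [bG | [u [f bv]]] := endo_cases b; last first.
    apply: E1I; have [a1 | [t [e [av tS eS]]]] := singI a aI; first exact: E1r.
    by rewrite (in_phi_set _ (mul_phi b av)) /endo_fun bv !phi_sing.
  move: aI; rewrite IE !in_setU -!orbA => /or4P[] aI.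
  - by rewrite cY.
  - suff -> : a * b \in plus_set Y by rewrite orbT.
    case/plus_setP: aI => c [t [e [cYc cv av]]]; apply/plus_setP.
    exists (c * b), (b t), (b e); rewrite cY // (mul_phi b cv) (mul_phi b av).
    by rewrite !expg2 endoM.
  - by rewrite cZ ?orbT.
  - by rewrite E1r ?orbT.
have [t [e av]] : exists t e, endo_val a = phi t e.
  have [/phi_setP[t [e [av _]]] | [t [e [av _ _]]]] := singI a aI;
    by exists t, e.
have [_ _ _ ee] := phi_endoP av.
have baI : endo_val (b * a) = phi t e -> b * a \in I.
  by move=> bav; suff -> : b * a = a by []; apply: endo_val_inj; rewrite bav.
case: (phi_mul b av) => bav.
- exact: baI.
- case: (typeI a aI) => [aY | aC | a1].
  + rewrite IE !in_setU; suff -> : b * a \in plus_set Y by rewrite orbT.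
    by apply/plus_setP; exists a, t, e.
  + apply: baI; move: aC; rewrite (in_phi_set _ av) => /and4P[_ /eqP t2 _ _].
    by rewrite bav -t2.
  + apply: baI; move: a1; rewrite (in_phi_set _ av) => /eqP te.
    by rewrite bav te expg2 ee.
- by apply: E1I; rewrite (in_phi_set _ bav).
- by apply: E1I; rewrite (in_phi_set _ bav).
Qed.

Lemma ideal_cases I : is_ideal I ->
  [\/ ideal_form1 I, ideal_form2 I, ideal_form3 I | ideal_form4 I].
Proof.
move=> idI; case: (boolP [exists a in I, a \in Gn n]) => [/exists_inP | noG].
  move=> [a aI aG].
  by constructor 1; apply/ideal_form1P; split=> //; exists a.
have nG a : a \in I -> a \notin Gn n.
  by move=> aI; apply: contra noG => aG; apply/exists_inP; exists a.
case: (boolP [exists a in I, a \in odd_type n]) => [/exists_inP | noodd].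
  move=> [a aI a3].
  constructor 2; apply/ideal_form2P; split=> //; last by exists a.
  by move=> IT; have := nG 1; rewrite IT in_setT Gn_one => /(_ isT).
have no3 a : a \in I -> a \notin odd_type n.
  by move=> aI; apply: contra noodd => a3; apply/exists_inP; exists a.
case: (boolP [exists a in I, a \in even_type n]) => [/exists_inP | noev].
  by move=> [a aI aE]; constructor 3; apply/ideal_form3P; split=> //; exists a.
constructor 4; apply/ideal_form4P; split=> // a aI.
have [aG | [t [e av]]] := endo_cases a; first by case/negP: (nG a aI).
have: a \notin even_type n.
  by apply: contra noev => aE; apply/exists_inP; exists a.
have := phi_type av; rewrite (negPf (no3 a aI)) trivial_or_nonpermE -idem_phiE.
rewrite !in_setU negb_or.
by case: (a \in endoA n); case: (a \in endoE2 n) => //=; rewrite orbA.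
Qed.

End Endomorphisms.

Theorem corollary5p7 (n : nat) (hn : (5 <= n)%N) :
  (forall I : {set endo n}, is_ideal I ->
     [\/ ideal_form1 I, ideal_form2 I, ideal_form3 I | ideal_form4 I])
  /\ forall I : {set endo n},
  [/\ ideal_form1 I <-> is_ideal I /\ (exists2 a, a \in I & a \in Gn n),
      ideal_form2 I <->
        [/\ is_ideal I, I <> [set: endo n] & exists2 a, a \in I & a \in odd_type n],
      ideal_form3 I <->
        [/\ is_ideal I, exists2 a, a \in I & a \in even_type n
          & forall a, a \in I -> a \notin odd_type n]
    & ideal_form4 I <->
        is_ideal I /\
        (forall a, a \in I -> a \in trivial_type n :|: nonperm_type n)].
Proof.
split=> [|I]; first exact: ideal_cases.
split; first exact: ideal_form1P.
- exact: ideal_form2P.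
- exact: ideal_form3P.
- exact: ideal_form4P.
Qed.
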